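(* Let $P$ be a poset satisfying one of the following conditions: (i) the set $\mathrm{Id}(P)$ of all ideals of $P$ is countable; (ii) $P$ is a $c$-poset; (iii) $P$ is an $\ell f_\omega$-poset; (iv) $P$ is an $\ell c_\omega$-poset; (v) $\Sigma(P\times P)=\Sigma P\times\Sigma P$. Suppose that $P$ also satisfies one of the following conditions: (a) $(P,\lambda(P))$ is compact; (b) $(P,\lambda(P))$ is upper semicompact; (c) $\Sigma P$ is well-filtered and coherent; (d) $P$ has property R. Then $\Sigma P$ is sober.
   Context: Order notions. A subset $D$ of a poset is directed if it is nonempty and any two elements of $D$ have an upper bound in $D$. For $A\subseteq P$, $\mathord{\downarrow}A=\{x: x\le a\text{ for some }a\in A\}$, $\mathord{\uparrow}A=\{x: x\ge a\text{ for some }a\in A\}$, $\mathord{\uparrow}x=\mathord{\uparrow}\{x\}$. An ideal of $P$ is a directed lower subset; $\mathrm{Id}(P)$ is the set of ideals; ideals $\mathord{\downarrow}x$ are principal; $\mathrm{Id}_{\neg p}(P)$ is the set of non-principal ideals. ''Countable'' means finite or countably infinite. Topologies. $U\subseteq P$ is Scott open if $U=\mathord{\uparrow}U$ and, for every directed $D\subseteq P$ such that $\bigvee D$ exists, $\bigvee D\in U$ implies $D\cap U\neq\emptyset$; these sets form $\sigma(P)$ and $\Sigma P=(P,\sigma(P))$. The lower topology $\omega(P)$ is generated by the subbase $\{P\setminus\mathord{\uparrow}x : x\in P\}$. The Lawson topology $\lambda(P)$ is generated by $\omega(P)\cup\sigma(P)$. $(P,\lambda(P))$ is upper semicompact if $\mathord{\uparrow}x$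 is compact in it for each $x\in P$. Compactness does not include Hausdorffness. $P\times P$ has the coordinatewise order, and (v) says $\sigma(P\times P)$ is the product topology. $c$-posets. $P$ is a $c$-poset if: (1) $\mathrm{Id}_{\neg p}(P)$ is countable, say $\{I_n : n\in N\}$ with $N\subseteq\mathbb{N}$ (possibly finite or empty); (2) for each $n\in N$ there is a strictly ascending sequence $c_{(n,1)}<c_{(n,2)}<\cdots$ in $P$ with $I_n=\mathord{\downarrow}\{c_{(n,m)}:m\in\mathbb{N}\}$; (3) there is a countable family $\{T_l:l\in\mathbb{N}\}$ of subsets of $P$ such that $P\setminus\bigcup_{n\in N}H_n=\bigcup_l T_l$ and every ideal of each poset $T_l$ (restricted order) is principal, where $H_n=\{c_{(n,m)}:m\in\mathbb{N}\}\cup\{\bigvee_m c_{(n,m)}\}$ if this supremum exists in $P$ and $H_n=\{c_{(n,m)}:m\in\mathbb{N}\}$ otherwise. $\ell c_\omega$- and $\ell f_\omega$-posets. A d-sub-poset of $P$ is a subset $S\subseteq P$ with the restricted order such that $\bigvee_P D\in S$ for every directed $D\subseteq S$ for which $\bigvee_P D$ exists. $P$ is an $\ell c_\omega$-poset (resp., $\ell f_\omega$-poset) if there is a sequence $(K_n)_{n\in\mathbb{N}}$ of d-sub-posets of $P$ such that: $\Sigma K_n$ is locally compact (resp., locally finite) for every $n$; $K_n\subseteq K_m$ whenever $n\le m$; $P=\bigcup_n K_n$; and $U\subseteq P$ is Scott open in $P$ iff $U\cap K_n$ is Scott open in $K_n$ for each $n$. A space is locally compact if every point has, inside each open neighborhood,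 a compact neighborhood. A $T_0$ space $X$ is locally finite if for each $x\in X$ and open $U\ni x$ there is a nonempty finite $F\subseteq X$ with $\mathord{\uparrow}F$ (in the specialization order) open and $x\in\mathord{\uparrow}F\subseteq U$. Property R. $P$ has property R if for any nonempty family $\{\mathord{\uparrow}F_i:i\in I\}$ with each $F_i\subseteq P$ nonempty finite and any $U\in\sigma(P)$, $\bigcap_{i\in I}\mathord{\uparrow}F_i\subseteq U$ implies $\bigcap_{i\in I_0}\mathord{\uparrow}F_i\subseteq U$ for some nonempty finite $I_0\subseteq I$. Space properties. A subset is saturated if it is an intersection of open sets. A $T_0$ space is well-filtered if for any open $U$ and any filtered (nonempty and downward directed under $\subseteq$) family $\mathcal{K}$ of nonempty compact saturated sets, $\bigcap\mathcal{K}\subseteq U$ implies $K\subseteq U$ for some $K\in\mathcal{K}$. It is coherent if the intersection of any two compact saturated sets is compact. A nonempty $A$ is irreducible if $A\subseteq F_1\cup F_2$ with $F_1,F_2$ closed implies $A\subseteq F_1$ or $A\subseteq F_2$; a space is sober if every irreducible closed subset is the closure of a unique point. *)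

(* Defs.v *)
From HB Require Import structures.
From mathcomp Require Import all_boot all_order.
From mathcomp Require Import boolp classical_sets functions cardinality.
From mathcomp Require Import topology.

Set Implicit Arguments.
Unset Strict Implicit.
Unset Printing Implicit Defensive.

Import Order.TTheory.
Local Open Scope classical_set_scope.
Local Open Scope order_scope.

(* The restricted order.  It applies to a subset [A : set P], viewed as a type
   through the coercion [set_type], which unfolds to a [sig] type. *)
HB.instance Definition _ d (P : porderType d) (p : pred P) :=
  [SubChoice_isSubPOrder of {x : P | p x} by <: with d].

Lemma le_set_type d (P : porderType d) (A : set P) (x y : A) :
  (x <= y) = (val x <= val y).
Proof. by []. Qed.

Definition downset d (P : porderType d) (A : set P) : set P :=
  [set x | exists2 a, A a & x <= a].

Definition upset d (P : porderType d) (A : set P) : set P :=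
  [set x | exists2 a, A a & a <= x].

Definition directed d (P : porderType d) (D : set P) : Prop :=
  D !=set0 /\
  forall x y, D x -> D y -> exists z, [/\ D z, x <= z & y <= z].

Definition ideal d (P : porderType d) (I : set P) : Prop :=
  directed I /\ downset I = I.

Definition principal d (P : porderType d) (I : set P) : Prop :=
  exists x, I = downset [set x].

Definition ideals d (P : porderType d) : set (set P) := [set I | ideal I].

Definition nonprincipal_ideals d (P : porderType d) : set (set P) :=
  [set I | ideal I /\ ~ principal I].

Arguments ideals {d} P.
Arguments nonprincipal_ideals {d} P.

(* [supremums D] is the set of least upper bounds of [D]: a singleton if the
   supremum of [D] exists, and empty otherwise. *)
Definition scott_open d (P : porderType d) (U : set P) : Prop :=
  upset U = U /\
  forall (D : set P) (s : P),
    directed D -> supremums D s -> U s -> D `&` U !=set0.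

Lemma scott_openT d (P : porderType d) : scott_open [set: P].
Proof.
split; first by apply/seteqP; split=> x //= _; exists x.
by move=> D s [[x Dx] _] _ _; exists x.
Qed.

Lemma scott_openI d (P : porderType d) : setI_closed (@scott_open d P).
Proof.
move=> U V [upU sU] [upV sV]; split.
  apply/seteqP; split=> [x [a [Ua Va] ax]|x UVx]; last by exists x.
  by split; [rewrite -upU|rewrite -upV]; exists a.
move=> D s dD Ds [Us Vs].
have [x [Dx Ux]] := sU _ _ dD Ds Us; have [y [Dy Vy]] := sV _ _ dD Ds Vs.
have [z [Dz xz yz]] := dD.2 _ _ Dx Dy; exists z; split=> //.
by split; [rewrite -upU; exists x|rewrite -upV; exists y].
Qed.

Lemma scott_open_bigU d (P : porderType d) (I : Type) (f : I -> set P) :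
  (forall i, scott_open (f i)) -> scott_open (\bigcup_i f i).
Proof.
move=> fo; split.
  apply/seteqP; split=> [x [a [i _ fia] ax]|x Ux]; last by exists x.
  by exists i => //; rewrite -(fo i).1; exists a.
move=> D s dD Ds [i _ fis].
by have [x [Dx fix_]] := (fo i).2 _ _ dD Ds fis; exists x; split=> //; exists i.
Qed.

(* The three topologies on [P], each carried by an alias of [P]. *)

Definition scott_space d (P : porderType d) : Type := P.
HB.instance Definition _ d (P : porderType d) :=
  Choice.copy (scott_space P) P.
HB.instance Definition _ d (P : porderType d) :=
  isOpenTopological.Build (scott_space P)
    (@scott_openT d P) (@scott_openI d P) (@scott_open_bigU d P).

Lemma scott_openE d (P : porderType d) :
  @open (scott_space P) = @scott_open d P.
Proof. by []. Qed.

Definition lower_space d (P : porderType d) : Type := P.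
HB.instance Definition _ d (P : porderType d) :=
  Choice.copy (lower_space P) P.
HB.instance Definition _ d (P : porderType d) :=
  @isSubBaseTopological.Build (lower_space P) (set P)
    [set ~` upset [set x] | x in [set: P]] id.

Definition lawson_space d (P : porderType d) : Type := P.
HB.instance Definition _ d (P : porderType d) :=
  Choice.copy (lawson_space P) P.
HB.instance Definition _ d (P : porderType d) :=
  @isSubBaseTopological.Build (lawson_space P) (set P)
    (@open (lower_space P) `|` @open (scott_space P)) id.

Definition lawson_compact d (P : porderType d) : Prop :=
  compact [set: lawson_space P].

Definition upper_semicompact d (P : porderType d) : Prop :=
  forall x : P, compact (upset [set x] : set (lawson_space P)).

Definition saturated (X : topologicalType) (A : set X) : Prop :=
  exists2 O : set (set X), O `<=` open & A = \bigcap_(U in O) U.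

(* Compactness does not include the Hausdorff axiom.  The library's
   [locally_compact] does not ask for arbitrarily small compact
   neighbourhoods. *)
Definition locally_compact_space (X : topologicalType) : Prop :=
  forall (x : X) (U : set X), open U -> U x ->
    exists K, [/\ compact K, nbhs x K & K `<=` U].

(* Specialization order: [x <= y] iff [x] lies in the closure of [{y}]. *)
Definition spec_upset (X : topologicalType) (F : set X) : set X :=
  [set y | exists2 x, F x & closure [set y] x].

Definition locally_finite (X : topologicalType) : Prop :=
  kolmogorov_space X /\
  forall (x : X) (U : set X), open U -> U x ->
    exists F : set X, [/\ F !=set0, finite_set F, open (spec_upset F),
                          spec_upset F x & spec_upset F `<=` U].

Definition well_filtered (X : topologicalType) : Prop :=
  kolmogorov_space X /\
  forall (U : set X) (KK : set (set X)),
    open U ->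
    KK !=set0 ->
    (forall K, KK K -> [/\ K !=set0, compact K & saturated K]) ->
    (forall K1 K2, KK K1 -> KK K2 ->
       exists K, [/\ KK K, K `<=` K1 & K `<=` K2]) ->
    \bigcap_(K in KK) K `<=` U ->
    exists2 K, KK K & K `<=` U.

Definition coherent (X : topologicalType) : Prop :=
  forall A B : set X, compact A -> saturated A -> compact B -> saturated B ->
    compact (A `&` B).

Definition irreducible (X : topologicalType) (A : set X) : Prop :=
  A !=set0 /\
  forall F1 F2 : set X, closed F1 -> closed F2 ->
    A `<=` F1 `|` F2 -> A `<=` F1 \/ A `<=` F2.

Definition sober (X : topologicalType) : Prop :=
  forall A : set X, irreducible A -> closed A ->
    exists! x : X, A = closure [set x].

Definition property_R d (P : porderType d) : Prop :=
  forall (I : Type) (F : I -> set P) (U : set P),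
    [set: I] !=set0 ->
    (forall i, F i !=set0 /\ finite_set (F i)) ->
    scott_open U ->
    \bigcap_i upset (F i) `<=` U ->
    exists I0 : set I,
      [/\ I0 !=set0, finite_set I0 & \bigcap_(i in I0) upset (F i) `<=` U].

(* The range of [c] together with its supremum when the latter exists. *)
Definition chain_with_sup d (P : porderType d) (c : nat -> P) : set P :=
  range c `|` supremums (range c).

(* [I] and [c] are defined on [N] only, so that an empty [P] is not excluded. *)
Definition c_poset d (P : porderType d) : Prop :=
  exists (N : set nat) (I : N -> set P) (c : N -> nat -> P) (T : nat -> set P),
    [/\ range I = nonprincipal_ideals P,
        (forall n : N,
           (forall m, c n m < c n m.+1) /\ I n = downset (range (c n))),
        ~` (\bigcup_(n : N) chain_with_sup (c n)) = \bigcup_l T l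
      & forall l (J : set (T l)), ideal J -> principal J].

Definition d_sub_poset d (P : porderType d) (S : set P) : Prop :=
  forall (D : set P) (s : P),
    directed D -> D `<=` S -> supremums D s -> S s.

(* Posets that are the union of an increasing sequence of d-sub-posets, whose
   Scott spaces have the property [Q], and which determine the Scott
   topology. *)
Definition l_omega_poset (Q : topologicalType -> Prop)
    d (P : porderType d) : Prop :=
  exists K : nat -> set P,
    [/\ (forall n, d_sub_poset (K n)),
        (forall n, Q (scott_space (K n))),
        (forall n m, (n <= m)%N -> K n `<=` K m),
        [set: P] = \bigcup_n K n
      & forall U : set P,
          scott_open U <->
          forall n, scott_open ((val : K n -> P) @^-1` U)].

Definition lc_omega_poset d (P : porderType d) : Prop :=
  l_omega_poset locally_compact_space P.

Definition lf_omega_poset d (P : porderType d) : Prop :=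
  l_omega_poset locally_finite P.

(* Here [P *p P] is the product with the coordinatewise order. *)
Definition scott_product d (P : porderType d) : Prop :=
  @open (scott_space (P *p P)) = @open (scott_space P * scott_space P)%type.

(* Main.v *)
From Stdlib Require List.
Require Import Defs.
From mathcomp Require Import all_boot all_order.
From mathcomp Require Import boolp classical_sets functions cardinality.
From mathcomp Require Import topology.

(** The heart of the matter is that both groups of hypotheses can be reduced to
a single statement each.

Every condition of the second group gives property R.  For the Lawson
conditions, the sets [upset F] with [F] finite are Lawson compact and Lawson
closed and Scott open sets are Lawson open, so property R is an instance of
compactness; for a well-filtered coherent space it is well-filteredness
applied to the finite intersections of the [upset (F i)].  Property R in turn
makes [P] a dcpo ([property_R_dcpo]).

Every condition of the first group gives [box_property P]: if a relation [O] on
[P] is Scott open in each variable separately and [O a b] holds, then [O]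
contains a product [V x W] of Scott open sets with [a] in [V] and [b] in [W].
This is the equality of the Scott topology of [P x P] with the product topology
([product_box]).  When [P] has countably many non-principal ideals, which
covers both countability conditions, [V] and [W] are generated by increasing
sequences of finite sets, into which an element of each ideal whose supremum
has been reached is put at some stage ([countable_nonprincipal_box]).  When
the topology is determined by locally compact pieces [K n], they are unions of
increasing sequences of compact sets, each interior to the next
([lc_omega_box]); locally finite pieces are locally compact.

Finally, let [A] be Scott closed and irreducible with complement [U], and let
[O x y] mean that all common upper bounds of [x] and [y] lie in [U].  Property R
makes [O] Scott open in each variable ([property_R_biopen]).  If [a] and [b] in
[A] had no common upper bound in [A], then [O a b] would hold, a box [V x W]
inside [O] would exist, and irreducibility would give a point [z] of [A] in both
[V] and [W]; but [O z z] puts [z] in [U].  So [A] is directed, its supremum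
exists and belongs to the closed set [A], and [A] is the closure of this
point. *)

Set Implicit Arguments.
Unset Strict Implicit.
Unset Printing Implicit Defensive.

Import Order.TTheory.
Local Open Scope order_scope.
Local Open Scope classical_set_scope.

(** * Compactness *)

(** The form of compactness suited to Scott topologies, whose open sets are
themselves tested on directed families: one member of a directed cover
suffices. *)
Lemma compact_directed_cover (X : topologicalType) (K : set X) (I : Type)
    (D : set I) (f : I -> set X) :
  compact K -> D !=set0 -> (forall i, D i -> open (f i)) ->
  (forall i j, D i -> D j -> exists k, [/\ D k, f i `<=` f k & f j `<=` f k]) ->
  K `<=` \bigcup_(i in D) f i -> exists2 i, D i & K `<=` f i.
Proof.
move=> cK D0 fo fdir Kf; apply: contrapT => nK.
pose F := filter_from D (fun i => K `\` f i).
have FF : ProperFilter F.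
  apply: filter_from_proper; first apply: filter_from_filter => //.
    move=> i j Di Dj; have [k [Dk ik jk]] := fdir _ _ Di Dj.
    by exists k => // x [Kx nfx]; split; split=> // ?; apply: nfx;
      [exact: ik|exact: jk].
  move=> i Di; apply: contrapT => Kfi; apply: nK; exists i => // x Kx.
  by apply: contrapT => nfx; apply: Kfi; exists x.
have FK : F K by have [i Di] := D0; exists i => // x [].
have [x [Kx clx]] := cK _ FF FK.
have [i Di fix_] := Kf _ Kx.
have [||y [[_ nfy] fy]] := clx (K `\` f i) (f i).
- by exists i.
- by apply: open_nbhs_nbhs; split=> //; exact: fo.
- exact: nfy.
Qed.

(** An open set that contains a point contains everything above it, so a cluster
point can be looked for in [F]: the filter is pushed down to the points of [F]
that are below some point of its members. *)
Lemma compact_spec_upset (X : topologicalType) (F : set X) :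
  finite_set F -> compact (spec_upset F).
Proof.
move=> Ffin H Hp HF.
pose G := filter_from H (fun A => [set x | F x /\ exists2 y, A y & closure [set y] x]).
have Gp : ProperFilter G.
  apply: filter_from_proper; first apply: filter_from_filter.
  - by exists (spec_upset F).
  - move=> A B HA HB; exists (A `&` B); first exact: filterI.
    by move=> z [Fz [y [Ay By] zy]]; split; split=> //; exists y.
  - move=> A HA; have [y [Ay [z Fz zy]]] := filter_ex (filterI HA HF).
    by exists z; split=> //; exists y.
have [|z [Fz clz]] := finite_compact Ffin Gp.
  by exists (spec_upset F) => // ? [].
exists z; split; first by exists z => //; exact: subset_closure.
move=> A B HA; rewrite nbhsE => -[C [Co Cz] CB].
have [||w [[Fw [y Ay wy]] Cw]] :=
  clz [set x | F x /\ exists2 y, A y & closure [set y] x] C.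
- by exists A.
- exact: open_nbhs_nbhs.
have [_ [-> Cy]] := wy C (open_nbhs_nbhs (conj Co Cw)).
by exists y; split=> //; exact: CB.
Qed.

(** The interiors of the compact subsets of [U] form a directed open cover of
[K]. *)
Lemma locally_compact_between (X : topologicalType) (K U : set X) :
  locally_compact_space X -> compact K -> open U -> K `<=` U ->
  exists L, [/\ compact L, K `<=` interior L & L `<=` U].
Proof.
move=> lcX cK Uo KU.
have [||i j [ci iU] [cj jU]|x /KU Ux|L [cL LU] KL] := @compact_directed_cover X K _
  [set L | compact L /\ L `<=` U] (@interior X) cK.
- by exists set0; split=> //; exact: compact0.
- by move=> L _; exact: open_interior.
- exists (i `|` j); split.
  + by split; [exact: compactU|move=> x [/iU|/jU]].
  + by apply: interiorS => x; left.
  + by apply: interiorS => x; right.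
- have [L [cL Lx LU]] := lcX _ _ Uo Ux; by exists L.
- by exists L.
Qed.

(** * Scott open sets *)

Lemma directed_finite_ubound d (P : porderType d) (D : set P) (T : Type)
    (J : set T) (g : T -> P) :
  directed D -> finite_set J -> (forall j, D (g j)) ->
  exists2 z, D z & forall j, J j -> g j <= z.
Proof.
move=> [[x0 Dx0] dD] /finite_setP[n] + Dg; elim: n J => [J|n IH J].
  by rewrite II0 card_eq0 => /eqP->; exists x0.
move=> /eq_cardSP[i Ji /IH[z Dz Jz]].
have [w [Dw zw iw]] := dD _ _ Dz (Dg i).
exists w => // j Jj; have [->//|ji] := pselect (j = i).
by apply: le_trans zw; apply: Jz.
Qed.

Lemma downset_directed d (P : porderType d) (D : set P) :
  directed D -> ideal (downset D).
Proof.
move=> [[x0 Dx0] dD]; split.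
  split; first by exists x0; exists x0.
  move=> x y [a Da xa] [b Db yb]; have [c [Dc ac bc]] := dD _ _ Da Db.
  exists c; split; first by exists c.
  - exact: le_trans ac.
  - exact: le_trans bc.
apply/seteqP; split=> [x [y [a Da ya] xy]|x Dx]; last by exists x.
by exists a => //; exact: le_trans ya.
Qed.

Lemma supremums_downset d (P : porderType d) (D : set P) (s : P) :
  supremums D s -> supremums (downset D) s.
Proof.
move=> [ubs lbs]; split=> [x [a Da xa]|u ubu].
  exact: le_trans (ubs _ Da).
by apply: lbs => a Da; apply: ubu; exists a.
Qed.

(** A directed set whose generated ideal is principal contains its supremum, so
Scott openness has content for non-principal ideals only. *)
Lemma scott_open_nonprincipal d (P : porderType d) (U : set P) :
  upset U = U ->
  (forall I s, nonprincipal_ideals P I -> supremums I s -> U s ->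
     I `&` U !=set0) ->
  scott_open U.
Proof.
move=> upU UI; split=> // D s dD Ds Us.
have sD := supremums_downset Ds.
suff [x [[a Da xa] Ux]] : downset D `&` U !=set0.
  by exists a; split=> //; rewrite -upU; exists x.
have [[x Dx]|npD] := pselect (principal (downset D)); last first.
  by apply: (UI _ s) => //; split=> //; exact: downset_directed.
have xD : downset D x by rewrite Dx; exists x.
have sx : s <= x by apply: sD.2 => y; rewrite Dx => -[z -> ].
by exists x; split=> //; rewrite -upU; exists s.
Qed.

Lemma scott_open_up d (P : porderType d) (U : set P) (x y : P) :
  scott_open U -> U x -> x <= y -> U y.
Proof. by move=> [<- _] [a Ua ax] xy; exists a => //; exact: le_trans xy. Qed.

Lemma scott_open_downset1C d (P : porderType d) (x : P) :
  scott_open (~` downset [set x]).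
Proof.
split.
  apply/seteqP; split=> [y [a na ay]|y ny]; last by exists y.
  by move=> [_ -> yx]; apply: na; exists x => //; exact: le_trans yx.
move=> D s dD Ds ns; apply: contrapT => Dx; apply: ns; exists x => //.
apply: Ds.2 => y Dy; apply: contrapT => nyx; apply: Dx; exists y; split=> //.
by move=> [_ ->].
Qed.

Lemma scott_closure1 d (P : porderType d) (x : P) :
  closure ([set x] : set (scott_space P)) = downset [set x].
Proof.
apply/seteqP; split=> y.
  move=> cly; apply: contrapT => nyx.
  have [|z [-> nz]] := cly (~` downset [set x]).
    apply: open_nbhs_nbhs; split=> //; exact: scott_open_downset1C.
  by apply: nz; exists x.
move=> [_ -> yx] B; rewrite nbhsE => -[V [Vo Vy] VB].
exists x; split=> //; apply: VB; exact: scott_open_up Vo Vy yx.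
Qed.

Lemma upset_upset d (P : porderType d) (A : set P) : upset (upset A) = upset A.
Proof.
apply/seteqP; split=> [x [y [a Aa ay] yx]|x Ax]; last by exists x.
by exists a => //; exact: le_trans yx.
Qed.

Lemma upset_bigcup1 d (P : porderType d) (A : set P) :
  upset A = \bigcup_(x in A) upset [set x].
Proof.
apply/seteqP; split=> [x [a Aa ax]|x [a Aa [_ -> ax]]]; last by exists a.
by exists a => //; exists a.
Qed.

Lemma spec_upset_scott d (P : porderType d) (A : set P) :
  spec_upset (A : set (scott_space P)) = upset A.
Proof.
apply/seteqP; split=> [x [a Aa]|x [a Aa ax]].
  by rewrite scott_closure1 => -[_ -> ax]; exists a.
by exists a => //; rewrite scott_closure1; exists x.
Qed.

Lemma upset_saturated d (P : porderType d) (A : set P) :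
  upset A = A -> saturated (A : set (scott_space P)).
Proof.
move=> upA; exists [set U | scott_open U /\ A `<=` U]; first by move=> U [].
apply/seteqP; split=> [x Ax U [_]|x UAx]; first exact.
apply: contrapT => nAx; have [] := UAx (~` downset [set x]); last by exists x.
split; first exact: scott_open_downset1C.
by move=> y Ay [_ -> yx]; apply: nAx; rewrite -upA; exists y.
Qed.

(** * Boxes in separately open relations *)

(** Scott openness in each variable separately.  It is equivalent to Scott openness
in the product poset, and is the form in which the relations below are both
proved open and used. *)
Definition biopen d1 d2 (P : porderType d1) (Q : porderType d2)
    (O : P -> Q -> Prop) :=
  (forall y, scott_open [set x | O x y]) /\ (forall x, scott_open (O x)).

Lemma biopenC d1 d2 (P : porderType d1) (Q : porderType d2)
    (O : P -> Q -> Prop) :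
  biopen O -> biopen (fun y x => O x y).
Proof. by move=> [O1 O2]. Qed.

(** A pointwise form of the inclusion of the Scott topology of [P x P] in the product
of the Scott topologies. *)
Definition box_property d (P : porderType d) :=
  forall (O : P -> P -> Prop) (a b : P), biopen O -> O a b ->
    exists V W, [/\ scott_open V, scott_open W, V a, W b &
                    forall x y, V x -> W y -> O x y].

(** The supremum of a directed subset of the product is computed coordinatewise;
moving one coordinate at a time into the two projections of the set gives two
members of it, and a common upper bound of both satisfies [O]. *)
Lemma biopen_scott_open d1 d2 (P : porderType d1) (Q : porderType d2)
    (O : P -> Q -> Prop) :
  biopen O -> scott_open [set p : P *p Q | O p.1 p.2].
Proof.
move=> bO; split.
  apply/seteqP; split=> [p [q Oq qp]|p Op]; last by exists p.
  move: qp; rewrite Order.ProdOrder.leEprod => /andP[qp1 qp2].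
  apply: scott_open_up (bO.2 _) _ qp2.
  exact: (@scott_open_up _ _ [set x | O x q.2] q.1) (bO.1 _) Oq qp1.
move=> D [s t] [[p0 Dp0] dD] [ubD lbD] /= Ost.
have le1 (p q : P *p Q) : p <= q -> p.1 <= q.1 /\ p.2 <= q.2.
  by rewrite Order.ProdOrder.leEprod => /andP[].
have dD1 : directed [set p.1 | p in D].
  split; first by exists p0.1; exists p0.
  move=> _ _ [p Dp <-] [q Dq <-]; have [r [Dr /le1[pr _] /le1[qr _]]] :=
    dD _ _ Dp Dq.
  by exists r.1; split=> //; exists r.
have dD2 : directed [set p.2 | p in D].
  split; first by exists p0.2; exists p0.
  move=> _ _ [p Dp <-] [q Dq <-]; have [r [Dr /le1[_ pr] /le1[_ qr]]] :=
    dD _ _ Dp Dq.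
  by exists r.2; split=> //; exists r.
have sD1 : supremums [set p.1 | p in D] s.
  split=> [_ [p Dp <-]|u ubu]; first by have [] := le1 _ _ (ubD _ Dp).
  suff : ((s, t) : P *p Q) <= ((u, t) : P *p Q).
    by rewrite Order.ProdOrder.leEprod => /andP[].
  apply: lbD => p Dp; rewrite Order.ProdOrder.leEprod /=.
  rewrite (le1 _ _ (ubD _ Dp)).2 andbT; apply: ubu; by exists p.
have sD2 : supremums [set p.2 | p in D] t.
  split=> [_ [p Dp <-]|u ubu]; first by have [] := le1 _ _ (ubD _ Dp).
  suff : ((s, t) : P *p Q) <= ((s, u) : P *p Q).
    by rewrite Order.ProdOrder.leEprod => /andP[].
  apply: lbD => p Dp; rewrite Order.ProdOrder.leEprod /=.
  rewrite (le1 _ _ (ubD _ Dp)).1 /=; apply: ubu; by exists p.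
have [_ [[p Dp <-] /= Opt]] := (bO.1 t).2 _ _ dD1 sD1 Ost.
have [_ [[q Dq <-] /= Opq]] := (bO.2 p.1).2 _ _ dD2 sD2 Opt.
have [r [Dr pr qr]] := dD _ _ Dp Dq; exists r; split=> //=.
apply: scott_open_up (bO.2 _) _ (le1 _ _ qr).2.
exact: (@scott_open_up _ _ [set x | O x q.2] p.1) (bO.1 _) Opq
  (le1 _ _ pr).1.
Qed.

Lemma product_box d (P : porderType d) : scott_product P -> box_property P.
Proof.
move=> Pprod O a b bO Oab.
have := biopen_scott_open bO.
rewrite -scott_openE Pprod openE => /(_ (a, b) Oab) [[V W] /= [aV bW] VW].
exists (interior (V : set (scott_space P))).
exists (interior (W : set (scott_space P))).
split=> //; try exact: (@open_interior (scott_space P)).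
move=> x y Vx Wy; apply: (VW (x, y)); split; exact: interior_subset.
Qed.

Lemma indexed_choice (T : Type) (inv : nat -> T -> Prop)
    (R : nat -> T -> T -> Prop) (x0 : T) :
  inv 0%N x0 ->
  (forall n x, inv n x -> exists2 y, inv n.+1 y & R n x y) ->
  exists u : nat -> T,
    [/\ u 0%N = x0, forall n, inv n (u n) & forall n, R n (u n) (u n.+1)].
Proof.
move=> inv0 step.
have /choice[f fP] : forall p : nat * T, exists y,
    inv p.1 p.2 -> inv p.1.+1 y /\ R p.1 p.2 y.
  move=> [n x] /=; have [/step[y ? ?]|ninv] := pselect (inv n x).
    by exists y.
  by exists x => /ninv.
pose u := fix u n := if n is m.+1 then f (m, u m) else x0.
have uinv n : inv n (u n) by elim: n => //= n /(fP (n, _))[].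
by exists u; split=> // n; have [] := fP (n, u n) (uinv n).
Qed.

(** * Countably many non-principal ideals *)

(** The one-step extension of a finite box [F x G]: the points [x] with [O x y] for
all [y] in the finite set [G] form a Scott open set, so if the supremum of [I] is
above a point of [F] this set contains an element of [I], which is added to
[F]. *)
Lemma biopen_witness d1 d2 (P : porderType d1) (Q : porderType d2)
    (O : P -> Q -> Prop) (F : seq P) (G : seq Q) (I : set P) :
  biopen O -> directed I ->
  (forall x y, x \in F -> y \in G -> O x y) ->
  exists F' : seq P, [/\ {subset F <= F'}, forall x y, x \in F' -> y \in G -> O x y &
    forall s x, supremums I s -> x \in F -> x <= s -> exists2 i, i \in F' & I i].
Proof.
move=> [O1 _] dI FG.
have [[s [x [Is Fx xs]]]|ns] :=
    pselect (exists s x, [/\ supremums I s, x \in F & x <= s]); last first.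
  by exists F; split=> // s x Is Fx xs; case: ns; exists s, x.
suff [i [Ii iG]] : I `&` [set i | forall y, y \in G -> O i y] !=set0.
  exists (i :: F); split=> [z Fz|z y|_ _ _ _ _].
  - by rewrite inE Fz orbT.
  - by rewrite inE => /orP[/eqP->|]; [exact: iG|exact: FG].
  - by exists i; rewrite ?inE ?eqxx.
have {}FG y : y \in G -> O s y.
  by move=> /(FG _ _ Fx) Oxy; apply: scott_open_up (O1 y) Oxy xs.
suff : scott_open [set i | forall y, y \in G -> O i y].
  by move=> [_ /(_ _ _ dI Is)]; apply.
elim: G {FG} => [|y G IH].
  rewrite (_ : [set _ | _] = setT); last by apply/seteqP; split.
  exact: scott_openT.
rewrite (_ : [set _ | _] = [set x | O x y] `&`
    [set i | forall y, y \in G -> O i y]); first exact: scott_openI.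
apply/seteqP; split=> [z Oz|z [Ozy Oz] t].
  split; first by apply: Oz; rewrite inE eqxx.
  by move=> t Gt; apply: Oz; rewrite inE Gt orbT.
by rewrite inE => /orP[/eqP->//|/Oz].
Qed.

(** Only non-principal ideals can violate Scott openness.  Finite boxes
[F n x G n] inside [O] grow from [{a} x {b}], and each non-principal ideal
receives attention at infinitely many stages; hence as soon as its supremum is
above a point of [F n], a later [F m] meets it, and likewise for [G]. *)
Lemma countable_nonprincipal_box d (P : porderType d) :
  countable (nonprincipal_ideals P) -> box_property P.
Proof.
move=> /countable_injP[f finj] O a b bO Oab.
pose inv (n : nat) (FG : seq P * seq P) :=
  forall x y, x \in FG.1 -> y \in FG.2 -> O x y.
pose catch (I : set P) (F F' : seq P) :=
  forall s x, supremums I s -> x \in F -> x <= s -> exists2 i, i \in F' & I i.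
pose R (n : nat) (FG FG' : seq P * seq P) :=
  [/\ {subset FG.1 <= FG'.1}, {subset FG.2 <= FG'.2} &
    forall I, nonprincipal_ideals P I -> f I = logn 2 n ->
      catch I FG.1 FG'.1 /\ catch I FG.2 FG'.2].
(* Stage [n] treats the ideal numbered [logn 2 n]: this takes each value for
   arbitrarily large [n]. *)
have [||u [u0 uinv uR]] := @indexed_choice _ inv R ([:: a], [:: b]).
- by move=> x y; rewrite !inE => /eqP-> /eqP->.
- move=> n [F G] /= FG.
  have [[I [Inp fI]]|nI] :=
      pselect (exists I, nonprincipal_ideals P I /\ f I = logn 2 n); last first.
    by exists (F, G) => //; split=> // I Inp fI; case: nI; exists I.
  have [F' [FF' F'G cF]] := biopen_witness bO Inp.1.1 FG.
  have [|G' [GG' G'F cG]] := @biopen_witness _ _ _ _ _ G F' I (biopenC bO) Inp.1.1.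
    by move=> x y /= Gx F'y; exact: F'G.
  exists (F', G'); first by move=> x y F'x G'y; exact: G'F.
  split=> // J Jnp fJ; rewrite (_ : J = I) //.
  by apply: finj; rewrite ?inE // fI.
have mono1 n m : (n <= m)%N -> {subset (u n).1 <= (u m).1}.
  move=> /subnK <-; elim: (m - n)%N => // k IH x /IH.
  by rewrite addSn; have [+ _ _] := uR (k + n)%N; apply.
have mono2 n m : (n <= m)%N -> {subset (u n).2 <= (u m).2}.
  move=> /subnK <-; elim: (m - n)%N => // k IH x /IH.
  by rewrite addSn; have [_ + _] := uR (k + n)%N; apply.
have upo (E : nat -> seq P) :
    (forall n m, (n <= m)%N -> {subset E n <= E m}) ->
    (forall n I, nonprincipal_ideals P I -> f I = logn 2 n ->
      catch I (E n) (E n.+1)) ->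
    scott_open [set x | exists2 n, true & exists2 e, e \in E n & e <= x].
  move=> Emono Ecatch; apply: scott_open_nonprincipal.
    apply/seteqP; split=> [x [y [n _ [e En ey]] yx]|x Ux]; last by exists x.
    by exists n => //; exists e => //; exact: le_trans yx.
  move=> I s Inp Is [k _ [e Eke es]].
  (* A stage at least [k] that treats [I]: an odd multiple of [2 ^ f I]. *)
  pose n := (2 ^ f I * k.*2.+1)%N.
  have fn : f I = logn 2 n.
    rewrite lognM ?expn_gt0 // pfactorK // lognE /=.
    by rewrite dvdn2 /= odd_double addn0.
  have kn : (k <= n)%N.
    rewrite (@leq_trans k.*2.+1) // ?leq_pmull ?expn_gt0 //.
    by rewrite -addnn leqW // leq_addr.
  have [i Ei Ii] := Ecatch _ _ Inp fn _ _ Is (Emono _ _ kn _ Eke) es.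
  by exists i; split=> //; exists n.+1 => //; exists i.
exists [set x | exists2 n, true & exists2 e, e \in (u n).1 & e <= x].
exists [set x | exists2 n, true & exists2 e, e \in (u n).2 & e <= x].
split.
- apply: upo => // n I Inp fI; have [_ _ /(_ _ Inp fI)[]//] := uR n.
- apply: upo => // n I Inp fI; have [_ _ /(_ _ Inp fI)[]//] := uR n.
- by exists 0%N => //; exists a; rewrite // u0 inE.
- by exists 0%N => //; exists b; rewrite // u0 inE.
move=> x y [n _ [e En ex]] [m _ [e' Em ey]].
have Oee' : O e e'.
  apply: (uinv (maxn n m)).
    by apply: mono1 En; exact: leq_maxl.
  by apply: mono2 Em; exact: leq_maxr.
apply: scott_open_up (bO.2 x) _ ey.
exact: (@scott_open_up _ _ [set x | O x e'] e x) (bO.1 e') Oee' ex.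
Qed.
(** * Increasing unions of locally compact pieces *)

Lemma locally_finite_compact (X : topologicalType) :
  locally_finite X -> locally_compact_space X.
Proof.
move=> [_ lfX] x U Uo Ux; have [F [_ Ffin Fo Fx FU]] := lfX _ _ Uo Ux.
exists (spec_upset F); split=> //; last by apply: open_nbhs_nbhs.
exact: compact_spec_upset.
Qed.

Lemma l_omega_sub (Q Q' : topologicalType -> Prop) d (P : porderType d) :
  (forall X, Q X -> Q' X) -> l_omega_poset Q P -> l_omega_poset Q' P.
Proof.
by move=> QQ' [K [K1 K2 K3 K4 K5]]; exists K; split=> // n; exact: QQ'.
Qed.

(** The tube lemma for Scott topologies.  If the supremum of a directed [D] lies in
the set, the slices of [O] at the members of [D] form a directed open cover of
[C]. *)
Lemma biopen_tube d1 d2 (P : porderType d1) (Q : porderType d2)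
    (O : P -> Q -> Prop) (C : set P) :
  biopen O -> compact (C : set (scott_space P)) ->
  scott_open [set y | forall x, C x -> O x y].
Proof.
move=> [O1 O2] cC; split.
  apply/seteqP; split=> [y [z Cz zy] x Cx|y Cy]; last by exists y.
  exact: scott_open_up (O2 x) (Cz _ Cx) zy.
move=> D s [[d0 Dd0] dD] Ds Cs.
have [||i j Di Dj|x Cx|y Dy Cy] := @compact_directed_cover (scott_space P) C _
  D (fun y => [set x | O x y]) cC.
- by exists d0.
- by move=> y _; exact: O1.
- have [k [Dk ik jk]] := dD _ _ Di Dj; exists k; split=> // x Ox.
    exact: scott_open_up (O2 x) Ox ik.
  exact: scott_open_up (O2 x) Ox jk.
- have [y [Dy Oy]] := (O2 x).2 _ _ (conj (ex_intro _ _ Dd0) dD) Ds (Cs _ Cx).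
  by exists y.
- by exists y.
Qed.

(** Enlarging one side at a time: [C'] is inside the open set of points that are
related to all of [C], so a compact neighbourhood [L'] of [C'] fits between them;
then [L'] plays the role of [C] for the other side. *)
Lemma biopen_compact_box d1 d2 (P : porderType d1) (Q : porderType d2)
    (O : P -> Q -> Prop) (C : set (scott_space P)) (C' : set (scott_space Q)) :
  locally_compact_space (scott_space P) ->
  locally_compact_space (scott_space Q) ->
  biopen O -> compact C -> compact C' ->
  (forall x y, C x -> C' y -> O x y) ->
  exists (L : set (scott_space P)) (L' : set (scott_space Q)),
    [/\ compact L, compact L', C `<=` interior L, C' `<=` interior L' &
        forall x y, L x -> L' y -> O x y].
Proof.
move=> lP lQ bO cC cC' CC'.
have [L' [cL' C'L' CL']] := locally_compact_between lQ cC' (biopen_tube bO cC)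
  (fun y C'y x Cx => CC' _ _ Cx C'y).
have [L [cL CL LL']] := locally_compact_between lP cC
  (biopen_tube (biopenC bO) cL') (fun x Cx y L'y => CL' _ L'y _ Cx).
by exists L, L'; split=> // x y /LL'; exact.
Qed.

Definition dcpo d (P : porderType d) :=
  forall D : set P, directed D -> supremums D !=set0.

Definition set_type_incl (T : Type) (S S' : set T) (SS' : S `<=` S') (x : S) : S' :=
  SigSub (mem_set (SS' _ (set_valP x))).

(** In a dcpo, directed suprema in a d-sub-poset are those of the whole poset, so
they are preserved by inclusions between d-sub-posets. *)
Lemma set_type_incl_continuous d (P : porderType d) (S S' : set P)
    (SS' : S `<=` S') :
  dcpo P -> d_sub_poset S ->
  continuous (set_type_incl SS' : scott_space S -> scott_space S').
Proof.
move=> dP dS; apply/continuousP => U Uo; split.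
  apply/seteqP; split=> [x [y Uy yx]|x Ux]; last by exists x.
  exact: (scott_open_up Uo Uy).
move=> D s [[x0 Dx0] dD] [ubD lbD] Us.
have dvD : directed (val @` D).
  split; first by exists (val x0); exists x0.
  move=> _ _ [x Dx <-] [y Dy <-]; have [z [Dz xz yz]] := dD _ _ Dx Dy.
  by exists (val z); split=> //; exists z.
have [t vDt] := dP _ dvD.
have St : S t by apply: dS dvD _ vDt => _ [x _ <-]; exact: set_valP.
have ts : t <= val s by apply: vDt.2 => _ [x Dx <-]; exact: ubD.
have st : val s <= t.
  apply: (lbD (SigSub (mem_set St))) => x Dx; apply: vDt.1; by exists x.
have {ts st} Et : val s = t by apply/eqP; rewrite eq_le ts st.
have [|||_ [[x Dx <-] Ux]] := Uo.2 (set_type_incl SS' @` D) (set_type_incl SS' s).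
- split; first by exists (set_type_incl SS' x0); exists x0.
  move=> _ _ [x Dx <-] [y Dy <-]; have [z [Dz xz yz]] := dD _ _ Dx Dy.
  by exists (set_type_incl SS' z); split=> //; exists z.
- split=> [_ [x Dx <-]|u ubu]; first exact: ubD.
  rewrite le_set_type /= Et; apply: vDt.2 => _ [x Dx <-].
  by apply: (ubu (set_type_incl SS' x)); exists x.
- by [].
- by exists x.
Qed.

(** Compactness in the Scott space of [S], for subsets of the ambient poset, so that
compact sets of different pieces can be compared. *)
Definition compact_in d (P : porderType d) (S C : set P) :=
  C `<=` S /\ compact (val @^-1` C : set (scott_space S)).

Lemma compact_in_widen d (P : porderType d) (S S' C : set P) :
  dcpo P -> d_sub_poset S -> S `<=` S' -> compact_in S C -> compact_in S' C.
Proof.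
move=> dP dS SS' [CS cC]; split; first exact: subset_trans SS'.
have := continuous_compact (continuous_subspaceT
  (@set_type_incl_continuous _ _ _ _ SS' dP dS)) cC.
congr compact; apply/seteqP; split=> [_ [x Cx <-] //|x Cx].
by exists (SigSub (mem_set (CS _ Cx))) => //; exact: val_inj.
Qed.

Lemma compact_in_image d (P : porderType d) (S : set P)
    (L : set (scott_space S)) :
  compact L -> compact_in S (val @` L) /\ val @^-1` (val @` L) = L.
Proof.
move=> cL; have vL : val @^-1` (val @` L) = L.
  by apply/seteqP; split=> [x [y Ly /val_inj <-]//|x Lx]; exists x.
by split=> //; split; [move=> _ [x _ <-]; exact: set_valP|rewrite vL].
Qed.

(** Compact boxes [C n x C' n] inside [O], with sides in the n-th piece, are chosen so
that each side is interior, within the next piece, to the next one.  The unions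
of the sides then have an open trace on every piece, and are Scott open. *)
Lemma lc_omega_box d (P : porderType d) :
  dcpo P -> lc_omega_poset P -> box_property P.
Proof.
move=> dP [K [dK lK Kmono Kcov Kopen]] O a b bO Oab.
have [na _ Kna] : (\bigcup_n K n) a by rewrite -Kcov.
have [nb _ Knb] : (\bigcup_n K n) b by rewrite -Kcov.
(* The stages are shifted by [n0] so that [a] and [b] belong to the first piece. *)
pose n0 := maxn na nb.
have bOn n : biopen (fun x y : K n => O (val x) (val y)).
  split=> [y|x]; first exact: (Kopen _).1 (bO.1 (val y)) n.
  exact: (Kopen _).1 (bO.2 (val x)) n.
pose inv n (CC : set P * set P) :=
  [/\ compact_in (K (n0 + n)%N) CC.1, compact_in (K (n0 + n)%N) CC.2 &
      forall x y, CC.1 x -> CC.2 y -> O x y].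
pose grows n (C C' : set P) := forall x : K (n0 + n).+1%N, C (val x) ->
  nbhs (x : scott_space (K (n0 + n).+1)) (val @^-1` C').
pose R n (CC LL : set P * set P) := grows n CC.1 LL.1 /\ grows n CC.2 LL.2.
have point (c : P) : K n0 c -> compact_in (K (n0 + 0)%N) [set c].
  rewrite addn0 => Kc; split; first by move=> _ ->.
  apply: finite_compact; apply: (@sub_finite_set _ _ [set SigSub (mem_set Kc)]).
    by move=> x /= xc; apply: val_inj.
  exact: finite_set1.
have [||u [u0 uinv uR]] := @indexed_choice _ inv R ([set a], [set b]).
- split=> /= [||_ _ -> ->//]; apply: point.
    by apply: Kmono Kna; exact: leq_maxl.
  by apply: Kmono Knb; exact: leq_maxr.
- move=> n [C C'] [/= cC cC' CC'].
  have widen D : compact_in (K (n0 + n)%N) D -> compact_in (K (n0 + n).+1%N) D.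
    by apply: compact_in_widen => //; exact: Kmono.
  have [L [L' [cL cL' CL CL' LL']]] := biopen_compact_box (lK _) (lK _)
    (bOn (n0 + n).+1) (widen _ cC).2 (widen _ cC').2
    (fun x y => CC' (val x) (val y)).
  have [cvL vL] := compact_in_image cL; have [cvL' vL'] := compact_in_image cL'.
  exists (val @` L, val @` L').
    rewrite /inv addnS; split=> // _ _ [x Lx <-] [y L'y <-]; exact: LL'.
  by split=> x; rewrite /= ?vL ?vL'; [exact: CL|exact: CL'].
have subK n : (u n).1 `<=` K (n0 + n)%N /\ (u n).2 `<=` K (n0 + n)%N.
  by have [[+ _] [+ _] _] := uinv n.
have limit (E : nat -> set P) : (forall n, E n `<=` K (n0 + n)%N) ->
    (forall n, grows n (E n) (E n.+1)) ->
    (forall n m, (n <= m)%N -> E n `<=` E m) /\ scott_open (\bigcup_n E n).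
  move=> EK Egrows.
  have Emono n m : (n <= m)%N -> E n `<=` E m.
    move=> /subnK <-; elim: (m - n)%N => // k IH x /IH Ex.
    have Kx := Kmono _ _ (leqnSn _) _ (EK _ _ Ex).
    by have /nbhs_singleton := Egrows _ (SigSub (mem_set Kx)) Ex.
  split=> //; apply/Kopen => m; rewrite -scott_openE openE => x [k _ Ekx].
  pose j := maxn k m.
  have mj : K m `<=` K (n0 + j).+1%N.
    by apply: Kmono; rewrite leqW // (leq_trans (leq_maxr k m)) // leq_addl.
  have := Egrows j (set_type_incl mj x) (Emono _ _ (leq_maxl k m) _ Ekx).
  move=> /(@set_type_incl_continuous _ _ _ _ mj dP (dK m)).
  apply: (@filterS _ (nbhs (x : scott_space (K m))) _
    (set_type_incl mj @^-1` (val @^-1` E j.+1))).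
  by move=> y Ey; exists j.+1.
have [mono1 V1] := limit (fun n => (u n).1) (fun n => (subK n).1) (fun n => (uR n).1).
have [mono2 V2] := limit (fun n => (u n).2) (fun n => (subK n).2) (fun n => (uR n).2).
exists (\bigcup_n (u n).1), (\bigcup_n (u n).2); split=> //.
- by exists 0%N; rewrite // u0.
- by exists 0%N; rewrite // u0.
move=> x y [n _ xn] [m _ ym]; have [_ _] := uinv (maxn n m); apply.
- exact: mono1 (leq_maxl n m) _ xn.
- exact: mono2 (leq_maxr n m) _ ym.
Qed.

(** * Property R *)

(** Lists with [List.In] index the finite intersections because the index type [I]
of property R carries no equality test. *)
Definition finite_upsets d (P : porderType d) (I : Type) (F : I -> set P)
    (s : seq I) : set P :=
  [set x | forall i, List.In i s -> upset (F i) x].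

Lemma finite_upsets_upset d (P : porderType d) (I : Type) (F : I -> set P) s :
  upset (finite_upsets F s) = finite_upsets F s.
Proof.
apply/seteqP; split=> [x [y Fy yx] i si|x Fx]; last by exists x.
by rewrite -upset_upset; exists y => //; exact: Fy.
Qed.

Lemma finite_upsets_nil d (P : porderType d) (I : Type) (F : I -> set P) :
  finite_upsets F [::] = setT.
Proof. by apply/seteqP; split=> x // _ i []. Qed.

Lemma finite_upsets_cons d (P : porderType d) (I : Type) (F : I -> set P) i s :
  finite_upsets F (i :: s) = upset (F i) `&` finite_upsets F s.
Proof.
apply/seteqP; split=> [x Fx|x [Fix_ Fx] j]; last by case=> [<-|/Fx].
by split; [apply: Fx; left|move=> j sj; apply: Fx; right].
Qed.

Lemma finite_upsets_cat d (P : porderType d) (I : Type) (F : I -> set P) s t :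
  finite_upsets F (s ++ t) = finite_upsets F s `&` finite_upsets F t.
Proof.
elim: s => [|i s IH]; last by rewrite cat_cons !finite_upsets_cons IH setIA.
by rewrite finite_upsets_nil setTI.
Qed.

(** A distinguished index [i0] makes the finite subfamily nonempty, and gives the
compactness arguments a compact set to start from. *)
Lemma property_R_seq d (P : porderType d) :
  (forall (I : Type) (F : I -> set P) (U : set P) (i0 : I),
    (forall i, finite_set (F i)) -> scott_open U ->
    \bigcap_i upset (F i) `<=` U ->
    exists s, finite_upsets F (i0 :: s) `<=` U) ->
  property_R P.
Proof.
move=> PR I F U [i0 _] Ffin Uo FU.
have [s sU] := PR I F U i0 (fun i => (Ffin i).2) Uo FU.
exists (fun i => List.In i (i0 :: s)); split; first by exists i0; left.
  elim: (i0 :: s) => [|i t IH]; first exact: finite_set0.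
  rewrite (_ : (fun _ => _) = [set i] `|` (fun j => List.In j t)).
    by rewrite finite_setU; split=> //; exact: finite_set1.
  by apply/seteqP; split=> j [|]; [left|right|left|right].
by move=> x Fx; apply: sU => i si; exact: Fx.
Qed.

Lemma lawson_open_scott d (P : porderType d) (U : set P) :
  scott_open U -> open (U : set (lawson_space P)).
Proof.
move=> Uo; exists [set U]; last by rewrite bigcup_set1.
by move=> _ ->; apply: finI_from1; right.
Qed.

Lemma lawson_closed_upset1 d (P : porderType d) (x : P) :
  closed (upset [set x] : set (lawson_space P)).
Proof.
rewrite -[upset _]setCK; apply: open_closedC.
exists [set ~` upset [set x]]; last by rewrite bigcup_set1.
move=> _ ->; apply: finI_from1; left.
exists [set ~` upset [set x]]; last by rewrite bigcup_set1.
by move=> _ ->; apply: (finI_from1 id); exists x.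
Qed.

Lemma lawson_compact_upper d (P : porderType d) :
  lawson_compact P -> upper_semicompact P.
Proof.
move=> cP x; apply: subclosed_compact cP _ => //.
exact: lawson_closed_upset1.
Qed.

(** The cover of [upset (F i0)] consists of the sets [U `|` ~` finite_upsets F s],
directed under concatenation of the lists [s]. *)
Lemma upper_semicompact_property_R d (P : porderType d) :
  upper_semicompact P -> property_R P.
Proof.
move=> cP; apply: property_R_seq => I F U i0 Ffin Uo FU.
have cF i : compact (upset (F i) : set (lawson_space P)).
  have /finite_seqP[s Fs] := Ffin i.
  rewrite upset_bigcup1 Fs bigcup_seq; apply: bigsetU_compact => x _; exact: cP.
have clF i : closed (upset (F i) : set (lawson_space P)).
  rewrite upset_bigcup1; apply: closed_bigcup => // x _.
  exact: lawson_closed_upset1.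
have [||s t _ _|x _|s _ sU] := @compact_directed_cover (lawson_space P)
  (upset (F i0)) _ setT (fun s => U `|` ~` finite_upsets F s) (cF i0).
- by exists [::].
- move=> s _; apply: openU; first exact: lawson_open_scott.
  apply: closed_openC.
  elim: s => [|i s IH].
    by rewrite finite_upsets_nil; exact: closedT.
  by rewrite finite_upsets_cons; exact: closedI.
- exists (s ++ t); rewrite finite_upsets_cat setCI; split=> //.
    by move=> x [Ux|sx]; [left|right; left].
  by move=> x [Ux|tx]; [left|right; right].
- have [Ux|nUx] := pselect (U x); first by exists [::] => //; left.
  have [i nix] : exists i, ~ upset (F i) x.
    by apply/existsNP => Fx; apply: nUx; apply: FU => i _; exact: Fx.
  by exists [:: i] => //; right=> Fx; apply: nix; apply: Fx; left.
- exists s; rewrite finite_upsets_cons => x [/sU[//|nsx] sx].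
  by case: nsx.
Qed.

(** The finite intersections of the [upset (F i)] that involve the index [i0] are
compact by coherence and form a filtered family; if one of them is empty the
conclusion is immediate, and otherwise well-filteredness applies. *)
Lemma well_filtered_coherent_property_R d (P : porderType d) :
  well_filtered (scott_space P) -> coherent (scott_space P) -> property_R P.
Proof.
move=> [_ wfP] coP; apply: property_R_seq => I F U i0 Ffin Uo FU.
have cF i : compact (upset (F i) : set (scott_space P)).
  by rewrite -spec_upset_scott; exact: compact_spec_upset.
have satF s : saturated (finite_upsets F s : set (scott_space P)).
  by apply: upset_saturated; exact: finite_upsets_upset.
have cFs i s : compact (finite_upsets F (i :: s) : set (scott_space P)).
  elim: s i => [|j s IH] i; rewrite finite_upsets_cons.
    by rewrite finite_upsets_nil setIT.
  apply: coP => //; apply: upset_saturated; exact: upset_upset.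
have [[s s0]|ns0] := pselect (exists s, finite_upsets F (i0 :: s) = set0).
  by exists s; rewrite s0.
have [||||K [s _ <-] sU] := wfP U (range (fun s => finite_upsets F (i0 :: s))) Uo.
- by exists (finite_upsets F [:: i0]); exists [::].
- move=> _ [s _ <-]; split=> //; apply/set0P/negP => /eqP s0.
  by apply: ns0; exists s.
- move=> _ _ [s _ <-] [t _ <-]; exists (finite_upsets F (i0 :: s ++ t)).
  rewrite !finite_upsets_cons finite_upsets_cat; split.
  + by exists (s ++ t) => //; rewrite finite_upsets_cons finite_upsets_cat.
  + by move=> x [? []].
  + by move=> x [? []].
- move=> x Fx; apply: FU => i _.
  have /= := Fx (finite_upsets F [:: i0; i]); apply; first by exists [:: i].
  by right; left.
- by exists s.
Qed.

(** * Sobriety *)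

(** Property R is applied to the principal upsets of the members of a directed
set [D]: a finite subset of [D] has an upper bound in [D], so that finite
intersections of these upsets are too large. *)
Lemma property_R_dcpo d (P : porderType d) : property_R P -> dcpo P.
Proof.
move=> PR D dD; have [[x0 Dx0] _] := dD; apply: contrapT => Dns.
have nlb b : ubound D b -> ~ lbound (ubound D) b.
  by move=> ubb lbb; apply: Dns; exists b.
(* Without a supremum, no upper bound of [D] is below all others: the set of
   upper bounds is disjoint from the Scott closed intersection of the principal
   ideals that they generate, whose complement is used here. *)
have [||||J [_ Jfin JU]] := PR {x | D x} (fun x => [set sval x])
  (\bigcup_(b in ubound D) ~` downset [set b]).
- by exists (exist _ x0 Dx0).
- by move=> x; split; [exists (sval x)|exact: finite_set1].
- rewrite bigcup_mkcond; apply: scott_open_bigU => b; case: ifPn => _.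
    exact: scott_open_downset1C.
  exact: (@open0 (scott_space P)).
- move=> y Dy.
  have uby : ubound D y.
    by move=> x Dx; have [_ -> //] := Dy (exist _ x Dx) I.
  have /existsNP[b /not_implyP[ubb nyb]] := nlb _ uby.
  by exists b => // -[_ -> ].
have [z Dz Jz] := directed_finite_ubound dD Jfin (@svalP _ _).
have [|b ubb] := JU z; first by move=> x Jx; exists (sval x) => //; exact: Jz.
by apply; exists b => //; exact: ubb.
Qed.

(** If the supremum [s] of a directed [D] satisfies the relation, then the
intersection of all [upset [set x]], [x] in [D], and of [upset [set y]] is inside
[U]; property R leaves finitely many of these [x], and one member of [D] above
them satisfies the relation. *)
Lemma property_R_biopen d (P : porderType d) (U : set P) :
  property_R P -> scott_open U ->
  biopen (fun x y => upset [set x] `&` upset [set y] `<=` U).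
Proof.
move=> PR Uo.
suff H y : scott_open [set x | upset [set x] `&` upset [set y] `<=` U].
  split=> [//|x]; have := H x; congr scott_open.
  by apply/seteqP; split=> z /=; rewrite setIC.
split.
  apply/seteqP; split=> [x [w wU wx] z [[_ -> xz] yz]|x xU]; last by exists x.
  by apply: wU; split=> //; exists w => //; exact: le_trans xz.
move=> D s dD [ubD lbD] sU; have [[x0 Dx0] _] := dD.
(* Indices [Some x] stand for the members of [D], [None] for the fixed [y]. *)
have [||||J [_ Jfin JU]] := PR (option {x | D x})
  (fun o => if o is Some x then [set sval x] else [set y]) U.
- by exists None.
- by case=> [x|]; split; [exists (sval x)|exact: finite_set1|exists y|exact: finite_set1].
- by [].
- move=> z Fz; apply: sU; split; last exact: (Fz None).
  exists s => //; apply: lbD => x Dx.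
  by have [_ ->] := Fz (Some (exist _ x Dx)) I.
have [|z Dz Jz] := directed_finite_ubound
  (g := fun o => if o is Some x then sval x else x0) dD Jfin.
  by case=> [x|//]; exact: svalP.
exists z; split=> // t [[_ -> zt] yt]; apply: JU => -[x|] // Jx.
by exists (sval x) => //; exact: le_trans (Jz (Some x) Jx) zt.
Qed.

(** When [P] is a join-semilattice the relation used here is the preimage of [U]
under the join, and the argument is the classical one based on joint
continuity of the join; property R replaces the existence of joins. *)
Lemma box_property_R_sober d (P : porderType d) :
  box_property P -> property_R P -> sober (scott_space P).
Proof.
move=> boxP PR A [[x0 Ax0] irrA] clA.
have Ao : scott_open (~` A) by exact: closed_openC clA.
have dA : directed A.
  split; first by exists x0.
  move=> a b Aa Ab; apply: contrapT => nab.
  have [|V [W [Vo Wo Va Wb VW]]] := boxP _ a b (property_R_biopen PR Ao).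
    move=> z [[_ -> az] [_ -> bz]] Az; apply: nab; exists z; by split.
  have [||z Az|AV|AW] := irrA (~` V) (~` W).
  - exact: (@open_closedC (scott_space P)).
  - exact: (@open_closedC (scott_space P)).
  - have [Vz|nVz] := pselect (V z); last by left.
    right=> Wz; apply: (VW z z Vz Wz z _ Az).
    by split; exists z.
  - exact: AV Aa Va.
  - exact: AW Ab Wb.
have [s As] := property_R_dcpo PR dA.
have Ass : A s.
  apply: contrapT => nAs; have [x [Ax nAx]] := Ao.2 _ _ dA As nAs.
  exact: nAx.
exists s; split; last first.
  move=> t At; have ss : A t by rewrite At; exact: subset_closure.
  apply/eqP; rewrite eq_le As.1 // andbT.
  by move: Ass; rewrite At scott_closure1 => -[_ ->].
rewrite scott_closure1; apply/seteqP; split=> [x Ax|x [_ -> xs]].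
  by exists s => //; exact: As.1.
apply: contrapT => nAx; have := scott_open_up Ao nAx xs; exact.
Qed.

Theorem theorem5p16 (d : Order.disp_t) (P : porderType d) :
  countable (ideals P) \/ c_poset P \/ lf_omega_poset P \/
    lc_omega_poset P \/ scott_product P ->
  lawson_compact P \/ upper_semicompact P \/
    (well_filtered (scott_space P) /\ coherent (scott_space P)) \/
    property_R P ->
  sober (scott_space P).
Proof.
move=> boxP RP.
have {RP} PR : property_R P.
  case: RP => [/lawson_compact_upper|[|[[]|//]]].
  - exact: upper_semicompact_property_R.
  - exact: upper_semicompact_property_R.
  - exact: well_filtered_coherent_property_R.
apply: box_property_R_sober => //.
case: boxP => [cI|[[N [I [c [T [NI _ _ _]]]]]|[lf|[lc|]]]].
- apply: countable_nonprincipal_box; apply: sub_countable cI.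
  by apply: subset_card_le => J [].
- apply: countable_nonprincipal_box; rewrite -NI.
  apply: (card_le_trans (card_image_le _ _)); exact: countableP.
- apply: lc_omega_box; first exact: property_R_dcpo.
  exact: l_omega_sub locally_finite_compact lf.
- by apply: lc_omega_box => //; exact: property_R_dcpo.
- exact: product_box.
Qed.
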